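(* For $n\geq 2$, the number of permutations $\pi\in\mathcal{S}_n$ such that both $\pi$ and $\pi^2$ have at most one descent equals $\binom{n+1}{3}+1$.
   Context: $\mathcal{S}_n$ is the symmetric group on $[n]$; a permutation $\pi=\pi_1\cdots\pi_n$ (one-line notation, $\pi_i=\pi(i)$) has a descent at $i\in[n-1]$ if $\pi_i>\pi_{i+1}$. $\pi^2(i)=\pi(\pi(i))$. *)

(* Defs.v *)
From mathcomp Require Import all_boot all_fingroup.

Set Implicit Arguments.
Unset Strict Implicit.
Unset Printing Implicit Defensive.

(* Positions and values are 0-based: the paper's [n] is 'I_n, shifted by one.
   The last position of 'I_n has no successor j, hence is never a descent. *)
Definition is_descent (n : nat) (s : 'S_n) (i : 'I_n) : bool :=
  [exists j : 'I_n, (j == i.+1 :> nat) && (s j < s i)].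

Definition des (n : nat) (s : 'S_n) : nat := #|[set i | is_descent s i]|.

(* Main.v *)
Require Import Defs.
From mathcomp Require Import all_boot all_fingroup.
From mathcomp Require Import zify.

(**
Besides the identity, the permutations counted are exactly the exchanges of two
adjacent blocks [a, b) and [b, c), and these are indexed by the 3-subsets
{a < b < c} of {0, ..., n}.  The square of a block exchange, seen as a rotation
of [a, c), is again one (or the identity).  Conversely, let f be increasing
except at f (d-1) > f d, with first and last moved points a and l.  Then f d = a
and f (d-1) = l.  If f a < f l, then f^2 has a descent f l > f a at the same
place d, so f^2 is increasing on both sides of d; since f^2 d = f a > a, the value
a of f^2 can only be taken at a, i.e. f a = d, and likewise f l = d-1, which is
absurd.  So f l < f a, and this forces f to be a block exchange.
*)

(** [d] is the position just after the one allowed descent; [d = 0] allows none. *)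
Definition increasing_except (d : nat) (f : nat -> nat) : Prop :=
  forall i, i.+1 <> d -> f i < f i.+1.

(** Each strict step gains at least 1, and the side condition keeps the step into [d] out of the way
    from [i] to [j]. *)
Lemma increasing_except_gap d f i j : increasing_except d f ->
  i <= j -> (j < d) || (d <= i) -> f i + (j - i) <= f j.
Proof.
move=> finc; elim: j => [|j IHj] le_ij sided.
  have -> : i = 0 by lia.
  lia.
have [eq_ij | ne_ij] := eqVneq i j.+1; first by rewrite -eq_ij; lia.
have := finc j; have := IHj; lia.
Qed.

(** * Block exchanges as maps of [nat] *)

Definition block_swap (a b c i : nat) : nat :=
  if i < a then i else
  if i < b then i + (c - b) else
  if i < c then i - (b - a) else i.

Section BlockSwap.

Variables a b c : nat.
Hypotheses (le_ab : a <= b) (le_bc : b <= c).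

Lemma block_swap_inj : injective (block_swap a b c).
Proof. by move=> i j; rewrite /block_swap; do !case: ifP; lia. Qed.

Lemma increasing_except_block_swap : increasing_except b (block_swap a b c).
Proof. by move=> i; rewrite /block_swap; do !case: ifP; lia. Qed.

(** The exchange rotates [[a, c)] by [c - b], so its square rotates by twice that modulo [c - a];
    this amount is [c - b']. The bounds on [b'] are weak because the square may be the identity. *)
Lemma block_swap_twice : exists2 b', a <= b' <= c &
  forall i, block_swap a b c (block_swap a b c i) = block_swap a b' c i.
Proof.
have [le_cb | lt_cb] := leqP (c - b) (b - a).
  exists (b - (c - b)); first by lia.
  by move=> i; rewrite /block_swap; do !case: ifP; lia.
exists (c - (c - b - (b - a))); first by lia.
by move=> i; rewrite /block_swap; do !case: ifP; lia.
Qed.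

End BlockSwap.

(** The first moved point is [a], the last is [c.-1], and the image [a + (c - b)] of [a] then
    determines [b]. *)
Lemma block_swap_eq a b c a' b' c' : a < b < c -> a' < b' < c' ->
  block_swap a b c =1 block_swap a' b' c' -> [/\ a = a', b = b' & c = c'].
Proof.
move=> lt_abc lt_abc' eq_sw.
have eq_a : a = a'.
  by case: (ltngtP a a') => // ?; [have := eq_sw a | have := eq_sw a'];
     rewrite /block_swap; do !case: ifP; lia.
have eq_c : c = c'.
  by case: (ltngtP c c') => // ?; [have := eq_sw c'.-1 | have := eq_sw c.-1];
     rewrite /block_swap; do !case: ifP; lia.
split=> //; have := eq_sw a; rewrite /block_swap; do !case: ifP; lia.
Qed.

(** * Maps with two increasing runs *)

Lemma first_last_moved (n : nat) (f : nat -> nat) i : f i != i ->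
  (forall j, n <= j -> f j = j) ->
  exists a l, [/\ f a != a, f l != l & forall j, (j < a) || (l < j) -> f j = j].
Proof.
move=> moved_i fix_ge.
have exm : exists j, f j != j by exists i.
have bnd j : f j != j -> j <= n.
  by case: (leqP j n) => // /ltnW /fix_ge ->; rewrite eqxx.
case: (ex_minnP exm) => a moved_a min_a.
case: (ex_maxnP exm bnd) => l moved_l max_l.
exists a, l; split=> // j out; apply/eqP; apply: contraLR out => moved_j.
by have := min_a j moved_j; have := max_l j moved_j; lia.
Qed.

Section TwoIncreasingRuns.

Variables (f : nat -> nat) (d e a l : nat).
Hypotheses (f_inj : injective f) (f_surj : forall v, exists i, f i = v).
Hypotheses (f_inc : increasing_except d f).
Hypotheses (moved_a : f a != a) (moved_l : f l != l).
Hypothesis fix_out : forall j, (j < a) || (l < j) -> f j = j.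

Let gap i j := increasing_except_gap d f i j f_inc.

(** Outside points are their own images, so by injectivity no inside point lands on them. *)
Lemma image_inside j : a <= j <= l -> a <= f j <= l.
Proof.
move=> in_j; case: (boolP ((f j < a) || (l < f j))) => [out|]; last by lia.
by have := f_inj _ _ (fix_out _ out); lia.
Qed.

Lemma le_first_last : a <= l.
Proof.
case: (leqP a l) => // lt_la.
by move: moved_a; rewrite fix_out ?eqxx // lt_la orbT.
Qed.

(** The least value [a] of the interval must occur at the start of a run; as [a] is moved, this is
    the second run. Dually, [l] occurs at the end of the first. *)
Lemma image_around_descent : [/\ a < d <= l, f d = a & f d.-1 = l].
Proof.
have le_al := le_first_last.
have in_a := image_inside a; have in_l := image_inside l.
have [x fx] := f_surj a; have [y fy] := f_surj l.
have x_in : a < x <= l.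
  have := fix_out x; have [eq_xa|] := eqVneq x a; last by lia.
  by move: moved_a; rewrite -eq_xa fx; lia.
have y_in : a <= y < l.
  have := fix_out y; have [eq_yl|] := eqVneq y l; last by lia.
  by move: moved_l; rewrite -eq_yl fy; lia.
have := gap a x; have := gap d x; have := gap y l; have := gap y d.-1.
have := image_inside d; have := image_inside d.-1.
have [eq_xd | ne_xd] := eqVneq x d; have [eq_yd | ne_yd] := eqVneq y d.-1.
- by subst x y; split; lia.
all: lia.
Qed.

Lemma last_image_lt_first_image :
  increasing_except e (f \o f) -> f l < f a.
Proof.
move=> ff_inc; case: (ltnP (f l) (f a)) => // le_fal.
have [in_d fd fd1] := image_around_descent.
have lt_fal : f a < f l.
  rewrite ltn_neqAle le_fal andbT.
  by apply/eqP => /f_inj; lia.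
(* [f \o f] falls from [f l] at [d.-1] to [f a] at [d], which uses up its only exception. *)
have eq_ed : d = e.
  apply/eqP/negPn/negP => ne_de.
  by have := ff_inc d.-1; rewrite /= prednK; [rewrite fd1 fd; lia | lia].
have gap2 i j := increasing_except_gap _ _ i j ff_inc.
rewrite -eq_ed /= in gap2.
have in_a := image_inside a; have in_l := image_inside l.
have in_fa := image_inside (f a); have in_fl := image_inside (f l).
(* These are the points where [f \o f] takes the values [a] and [l]. *)
have [x fx] := f_surj d; have [y fy] := f_surj d.-1.
have x_in : a <= x <= l.
  by have := fix_out x; lia.
have y_in : a <= y <= l.
  by have := fix_out y; lia.
have eq_xa : x = a.
  have := gap2 a x; have := gap2 d x; rewrite fx fd; lia.
have eq_yl : y = l.
  have := gap2 y l; have := gap2 y d.-1; rewrite fy fd1; lia.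
by subst x y; lia.
Qed.

(** Unit growth on the runs gives [f a <= a + (l.+1 - d)] and [a + (l - d) <= f l]. With [f l < f a]
    both become equalities, which leaves no slack: [f] is a translation on each run. *)
Lemma block_swap_of_lt : f l < f a -> f =1 block_swap a d l.+1.
Proof.
move=> lt_fla i.
have [in_d fd fd1] := image_around_descent.
have [fa fl] : f a = l.+1 - d + a /\ f l = a + (l - d).
  by have := gap a d.-1; have := gap d l; rewrite fd fd1; lia.
rewrite /block_swap; case: ltnP => [lt_ia | le_ai].
  by rewrite fix_out ?lt_ia.
case: ltnP => [lt_id | le_di].
  by have := gap a i; have := gap i d.-1; rewrite fd1; lia.
case: ltnP => [lt_il | lt_li].
  by have := gap d i; have := gap i l; rewrite fd; lia.
by rewrite fix_out // lt_li orbT.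
Qed.

End TwoIncreasingRuns.

Lemma block_swap_of_increasing_except n f d e :
  injective f -> (forall v, exists i, f i = v) ->
  (forall j, n <= j -> f j = j) -> (exists i, f i != i) ->
  increasing_except d f -> increasing_except e (f \o f) ->
  exists a b c, a < b < c /\ c <= n /\ f =1 block_swap a b c.
Proof.
move=> f_inj f_surj fix_ge [i moved_i] f_inc ff_inc.
have [a [l [moved_a moved_l fix_out]]] := first_last_moved n f i moved_i fix_ge.
have [in_d _ _] := image_around_descent
  f d a l f_inj f_surj f_inc moved_a moved_l fix_out.
exists a, d, l.+1; split; [by lia|split].
  by case: (ltnP l n) => // /fix_ge fl; rewrite fl eqxx in moved_l.
apply: block_swap_of_lt => //.
exact: (last_image_lt_first_image f d e).
Qed.

(** * Permutations as maps of [nat] *)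

Section ExtendPermutation.

Variable n : nat.
Implicit Types s : 'S_n.

(** Extending by the identity yields a bijection of [nat], to which the results on maps apply
    directly. *)
Definition nat_of_perm s (i : nat) : nat :=
  if insub i is Some j then val (s j) else i.

Lemma nat_of_permE s (i : 'I_n) : nat_of_perm s i = s i.
Proof. by rewrite /nat_of_perm valK. Qed.

Lemma nat_of_perm_lt s i (lt_in : i < n) : nat_of_perm s i = s (Ordinal lt_in).
Proof. exact: nat_of_permE s (Ordinal lt_in). Qed.

Lemma nat_of_perm_ge s i : n <= i -> nat_of_perm s i = i.
Proof. by move=> le_ni; rewrite /nat_of_perm insubF // ltnNge le_ni. Qed.

Lemma nat_of_permM s t : nat_of_perm (s * t) =1 nat_of_perm t \o nat_of_perm s.
Proof.
move=> i /=; have [lt_in | le_ni] := ltnP i n; last by rewrite !nat_of_perm_ge.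
by rewrite !(nat_of_perm_lt _ _ lt_in) nat_of_permE permM.
Qed.

Lemma nat_of_perm1 : nat_of_perm 1 =1 id.
Proof.
move=> i; have [lt_in | le_ni] := ltnP i n; last by rewrite nat_of_perm_ge.
by rewrite nat_of_perm_lt perm1.
Qed.

Lemma nat_of_permK s : cancel (nat_of_perm s) (nat_of_perm s^-1).
Proof.
by move=> i; have := nat_of_permM s s^-1 i; rewrite mulgV nat_of_perm1 => /esym.
Qed.

Lemma nat_of_permVK s : cancel (nat_of_perm s^-1) (nat_of_perm s).
Proof. by move=> i; rewrite -{1}[s]invgK nat_of_permK. Qed.

Lemma nat_of_perm_inj s t : nat_of_perm s =1 nat_of_perm t -> s = t.
Proof.
move=> eq_st; apply/permP => i; apply/val_inj.
by have := eq_st i; rewrite !nat_of_permE.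
Qed.

Lemma is_descentE s (i j : 'I_n) :
  j = i.+1 :> nat -> is_descent s i = (s j < s i).
Proof.
move=> eq_ji; apply/existsP/idP => [[k /andP[/eqP eq_ki]] | lt_s].
  by have -> : k = j by apply/val_inj; rewrite /= eq_ki eq_ji.
by exists j; rewrite lt_s eq_ji eqxx.
Qed.

(** The extension creates no descent at the seam [i.+1 = n]: a value below [n] is followed by [n]
    itself. *)
Lemma nat_of_perm_lt_succ s i :
  (forall lt_in : i < n, ~~ is_descent s (Ordinal lt_in)) ->
  nat_of_perm s i < nat_of_perm s i.+1.
Proof.
move=> no_desc; have [lt_iSn | le_nSi] := ltnP i.+1 n; last first.
  rewrite [X in _ < X]nat_of_perm_ge //.
  have [lt_in | le_ni] := ltnP i n; last by rewrite nat_of_perm_ge.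
  by rewrite nat_of_perm_lt (leq_trans (ltn_ord _)).
have := no_desc (ltnW lt_iSn).
rewrite (is_descentE _ _ (Ordinal lt_iSn)) // -leqNgt leq_eqVlt.
rewrite (nat_of_perm_lt _ _ lt_iSn) (nat_of_perm_lt _ _ (ltnW lt_iSn)).
case/orP=> [/eqP/val_inj/perm_inj/(congr1 val) /= |//].
by lia.
Qed.

Lemma des_le1P s :
  reflect (exists d, increasing_except d (nat_of_perm s)) (des s <= 1).
Proof.
apply: (iffP idP) => [/card_le1_eqP des1 | [d sinc]].
  have [i0 desc0 | no_desc] := pickP (is_descent s); last first.
    (* Without descents, [0] serves as a void exception, being no successor. *)
    by exists 0 => i _; apply: nat_of_perm_lt_succ => lt_in; rewrite no_desc.
  exists i0.+1 => i ne_i; apply: nat_of_perm_lt_succ => lt_in.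
  apply/negP => desc_i; apply: ne_i.
  by have <- : Ordinal lt_in = i0 by apply: des1; rewrite inE.
have desc_d (i : 'I_n) : is_descent s i -> i.+1 = d.
  move=> desc_i; have /existsP[j /andP[/eqP eq_ji _]] := desc_i.
  apply/eqP/negPn/negP => /eqP /sinc.
  rewrite -eq_ji !nat_of_permE => lt_s.
  by move: desc_i; rewrite (is_descentE s i j) //; lia.
apply/card_le1_eqP => i j; rewrite !inE => /desc_d di /desc_d dj.
by apply/val_inj => /=; lia.
Qed.

Lemma exists_block_swap_perm a b c : a <= b -> b <= c -> c <= n ->
  exists s, nat_of_perm s =1 block_swap a b c.
Proof.
move=> le_ab le_bc le_cn.
have lt_sw (i : 'I_n) : block_swap a b c i < n.
  by have := ltn_ord i; rewrite /block_swap; do !case: ifP; lia.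
have sw_inj : injective (fun i => Ordinal (lt_sw i)).
  by move=> i j [/block_swap_inj eq_ij]; apply/val_inj/eq_ij.
exists (perm sw_inj) => i; have [lt_in | le_ni] := ltnP i n.
  by rewrite -[i]/(val (Ordinal lt_in)) nat_of_permE permE.
by rewrite nat_of_perm_ge // /block_swap; do !case: ifP; lia.
Qed.

(** * Indexing and counting by triples of cut points *)

Definition cut (t : 3.-tuple 'I_n.+1) (k : nat) : nat := nth ord0 t k.

(* Junk value 1 when no permutation restricts [sw], e.g. for some unsorted t. *)
Definition block_swap_perm (t : 3.-tuple 'I_n.+1) : 'S_n :=
  let sw := block_swap (cut t 0) (cut t 1) (cut t 2) in
  odflt 1%g [pick s : 'S_n | [forall i : 'I_n, s i == sw i :> nat]].

End ExtendPermutation.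

Arguments nat_of_perm {n} s i.
Arguments des_le1P {n s}.
Arguments cut {n} t k.
Arguments block_swap_perm {n} t.

(** Sorted tuples encode the 3-subsets of [{0, ..., n}] in the form that [card_ltn_sorted_tuples]
    counts. *)
Definition triples (n : nat) : {set 3.-tuple 'I_n.+1} :=
  [set t : 3.-tuple 'I_n.+1 | sorted ltn [seq val i | i <- t]].

Lemma triplesE n (t : 3.-tuple 'I_n.+1) :
  (t \in triples n) = (cut t 0 < cut t 1 < cut t 2).
Proof.
case: t => [[|a [|b [|c [|x t]]]] sz] //.
by rewrite inE /cut /= andbT.
Qed.

Lemma block_swap_permE n (t : 3.-tuple 'I_n.+1) : t \in triples n ->
  nat_of_perm (block_swap_perm t)
    =1 block_swap (cut t 0) (cut t 1) (cut t 2).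
Proof.
rewrite triplesE => lt_t; have lt_cn : cut t 2 < n.+1 := ltn_ord _.
have [||| s sE] := @exists_block_swap_perm n (cut t 0) (cut t 1) (cut t 2).
- by lia.
- by lia.
- by lia.
rewrite /block_swap_perm; case: pickP => [s' /forallP s'E i | /(_ s)] /=.
  have [lt_in | le_ni] := ltnP i n; first by rewrite nat_of_perm_lt (eqP (s'E _)).
  by rewrite -sE !nat_of_perm_ge.
(* The default is never reached: [s] passes the test of [pick]. *)
by case/forallP=> i; rewrite -nat_of_permE sE.
Qed.

Lemma block_swap_perm_inj n : {in triples n &, injective (@block_swap_perm n)}.
Proof.
move=> t u t_in u_in eq_tu.
have [||| e0 e1 e2] := @block_swap_eq (cut t 0) (cut t 1) (cut t 2)
  (cut u 0) (cut u 1) (cut u 2).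
- by rewrite -triplesE.
- by rewrite -triplesE.
- by move=> i; rewrite -!block_swap_permE // eq_tu.
move/val_inj: e0 => e0; move/val_inj: e1 => e1; move/val_inj: e2 => e2.
by apply: eq_from_tnth => -[[|[|[|//]]] lt_i3]; rewrite !(tnth_nth ord0).
Qed.

Lemma des_le1_square_perms n :
  [set s : 'S_n | (des s <= 1) && (des (s ^+ 2)%g <= 1)]
    = 1%g |: [set block_swap_perm t | t in triples n].
Proof.
apply/setP => s; rewrite !inE expgS expg1; apply/andP/orP.
  case=> /des_le1P[d sinc] /des_le1P[e ssinc].
  have [-> | ne_s1] := eqVneq s 1%g; [by left | right].
  have moved : exists i, nat_of_perm s i != i.
    have /existsP[i moved_i] : [exists i, s i != i].
      apply: contraR ne_s1 => /existsPn fixed.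
      by apply/eqP/permP => i; rewrite perm1; apply/eqP/negPn/fixed.
    by exists i; rewrite nat_of_permE.
  have [a [b [c [lt_abc [le_cn sE]]]]] := @block_swap_of_increasing_except
    n (nat_of_perm s) d e (can_inj (@nat_of_permK n s))
    (fun v => ex_intro _ _ (@nat_of_permVK n s v)) (@nat_of_perm_ge n s) moved
    sinc (fun i ne_i => ltac:(rewrite -!nat_of_permM; exact: ssinc)).
  (* Since [c <= n], [inord] preserves all three values. *)
  pose t : 3.-tuple 'I_n.+1 := [tuple inord a; inord b; inord c].
  have tE : [/\ cut t 0 = a :> nat, cut t 1 = b :> nat & cut t 2 = c :> nat].
    by rewrite /cut /= !inordK //; lia.
  have [t0 t1 t2] := tE.
  have t_in : t \in triples n by rewrite triplesE t0 t1 t2.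
  apply/imsetP; exists t => //; apply: nat_of_perm_inj => i.
  by rewrite sE block_swap_permE // t0 t1 t2.
case=> [/eqP-> | /imsetP[t t_in ->]].
  by rewrite mulg1; split; apply/des_le1P; exists 0 => i _; rewrite !nat_of_perm1.
have sE := block_swap_permE _ _ t_in; move: t_in; rewrite triplesE => lt_t.
split; apply/des_le1P.
  exists (cut t 1) => i; rewrite !sE; apply: increasing_except_block_swap; lia.
(* The square is the exchange with middle cut [b'], so its exception is at [b']. *)
have [||b' le_b' swE] := block_swap_twice (cut t 0) (cut t 1) (cut t 2).
- by lia.
- by lia.
exists b' => i; rewrite !nat_of_permM /= !sE !swE.
by apply: increasing_except_block_swap; lia.
Qed.

Theorem theorem2p4 (n : nat) (hn : 2 <= n) :
  #|[set s : 'S_n | (des s <= 1) && (des (s ^+ 2)%g <= 1)]| = 'C(n.+1, 3) + 1.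
Proof.
rewrite des_le1_square_perms cardsU1 card_in_imset; last exact: block_swap_perm_inj.
rewrite card_ltn_sorted_tuples addnC; congr (_ + _).
(* The identity is counted separately, since a proper exchange moves its first cut point. *)
apply/eqP; rewrite eqb1; apply/negP => /imsetP[t t_in].
move/(congr1 (fun s => nat_of_perm s (cut t 0))).
rewrite nat_of_perm1 block_swap_permE //; move: t_in; rewrite triplesE.
by rewrite /block_swap; do !case: ifP; lia.
Qed.
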